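(* For a parameter $q\in\mathbb{C}$ let $B_q$ be the algebra generated by $x_i$, $i\in\mathbb{Z}$, with defining relations $$\sum_{\alpha\in\mathbb{Z}}(-1)^{\alpha}q^{\frac{\alpha(3\alpha-1)}{2}}x_{i+3\alpha}x_{i+1-3\alpha}=0,\qquad i\in\mathbb{Z},$$ that is, the quotient of the algebra $A$ by the ideal generated by the left-hand sides. Then $B_q$ is a flat deformation of $B_0$ (where $B_0$ has the relations $x_ix_{i+1}=0$, $i\in\mathbb{Z}$).
   Context: Algebra $A$. Let $P=\mathbb{C}[x_i,\ i\in\mathbb{Z}]$, graded by $\mathbb{Z}^2$ with $\deg(x_i)=(i,1)$, so that $P_{n,l}$ is spanned by monomials $x_{i_1}^{a_1}\cdots x_{i_m}^{a_m}$ with $\sum a_ri_r=n$, $\sum a_r=l$. Let $A_{n,l}$ be the space of infinite formal sums (with complex coefficients) of monomials in $P_{n,l}$ and $A=\bigoplus_{n,l}A_{n,l}$; multiplication is well defined, and $A$ is a commutative associative $\mathbb{Z}^2$-graded algebra. Ideals. For homogeneous elements $g_i\in A$ ($i\in\mathbb{Z}$), the ideal generated by $\{g_i\}$ means the set of all infinite formal sums $\sum_i p_ig_i\in A$ with $p_i\in A$ (each such sum lying in a direct sum of finitely many homogeneous components $A_{n,l}$). Dimensions. Let $C_N\subset A$ be the ideal generated by $x_{N+1},x_{N+2},\dots$. For a graded quotient $Q$ of $A$, $\dim_N Q_{n,l}$ denotes the (finite) dimension of the $(n,l)$ graded component of $Q/C_N$, i.e. of the quotient of $Q$ by the image of $C_N$;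 statements with $\dim_N$ are always meant for $N\gg0$. Flatness. Let $I_q$ ($q$ a complex parameter) be the ideal generated by a family of homogeneous elements $m_\alpha(q)\in A$ such that $m_\alpha(0)$ are monomials. The deformation $A/I_q$ of $A/I_0$ is called flat if the dimensions of the graded components $(A/I_q)_{n,l}$ and $(A/I_0)_{n,l}$ are equal for all $n,l$, in the sense $\dim_N(A/I_q)_{n,l}=\dim_N(A/I_0)_{n,l}$ for $N\gg0$. Convention: $0^0=1$ (so at $q=0$ only the $\alpha=0$ term survives). *)

(* Defs.v *)
From HB Require Import structures.
From mathcomp Require Import all_boot all_order all_algebra.
From mathcomp Require Import finmap complex monalg.
From mathcomp Require Import boolp classical_sets functions cardinality fsbigop.
From mathcomp Require Import reals.

Set Implicit Arguments.
Unset Strict Implicit.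
Unset Printing Implicit Defensive.

Import Order.TTheory GRing.Theory Num.Theory.

Local Open Scope classical_set_scope.
Local Open Scope ring_scope.
Local Open Scope complex_scope.

(* A formal sum of monomials in the x_i is its family of coefficients. *)
Notation monom := {cmonom int}.
Notation fseries R := (monom -> R[i]).

(* The bidegree (sum_i a_i i, sum_i a_i) of prod_i x_i ^ a_i. *)
Definition bideg (m : monom) : int * int :=
  (\sum_(i <- finsupp m) i *+ m i, (mdeg m)%:Z).

Section FormalSums.
Variable R : realType.
Implicit Types (f g : fseries R) (i : int).

Definition fmono (m : monom) : fseries R := fun m' => (m' == m)%:R.

Definition fvar i : fseries R := fmono (ucm i).

(* The index set is finite, as a monomial has finitely many divisors. *)
Definition fmul f g : fseries R := fun m =>
  \sum_(u \in [set u : monom * monom | mmul u.1 u.2 = m]) f u.1 * g u.2.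

Definition component (d : int * int) : set (fseries R) :=
  [set f | forall m, f m != 0 -> bideg m = d].

Definition algA : set (fseries R) :=
  [set f | exists s : seq (int * int), forall m, f m != 0 -> bideg m \in s].

Definition homogeneous f := exists d, component d f.

(* An infinite sum of formal sums makes sense when every monomial occurs in
   finitely many terms. The finitely supported sum below is 0 otherwise. *)
Definition summable (I : choiceType) (F : I -> fseries R) :=
  forall m, finite_set [set k | F k m != 0].

Definition infsum (I : choiceType) (F : I -> fseries R) : fseries R :=
  fun m => \sum_(k \in [set: I]) F k m.

Definition gen_ideal (I : choiceType) (g : I -> fseries R) : set (fseries R) :=
  [set f | algA f /\ exists p : I -> fseries R,
     [/\ forall k, algA (p k),
         summable (fun k => fmul (p k) (g k))
       & f = infsum (fun k => fmul (p k) (g k))]].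

Definition cutoff (N : int) : set (fseries R) :=
  gen_ideal (fun k : nat => fvar (N + k.+1%:Z)).

Definition add_ideal (J K : set (fseries R)) : set (fseries R) :=
  [set f \+ g | f in J & g in K].

(* The quotient of V by its intersection with W has dimension n: it has a basis
   formed by the classes of b 0, ..., b (n - 1). *)
Definition quot_dim (V W : set (fseries R)) (n : nat) :=
  exists b : 'I_n -> fseries R,
    (forall j, V (b j)) /\
    forall f, V f -> exists! c : 'rV[R[i]]_n,
      W (fun m => f m - \sum_(j < n) c 0 j * b j m).

(* dim_N (algA / J)_d = n. The quotient of algA / J by the image of cutoff N
   is algA / (J + cutoff N). *)
Definition dimN (N : int) (J : set (fseries R)) (d : int * int) (n : nat) :=
  quot_dim (component d) (add_ideal J (cutoff N)) n.

(* How large N has to be may depend on q and on the degree d. *)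
Definition flat_deformation (I : choiceType) (g : R[i] -> I -> fseries R)
    (q : R[i]) :=
  [/\ forall q' k, homogeneous (g q' k),
      forall k, exists m, g 0 k = fmono m
    & forall d, exists N0 : int, forall N : int, N0 <= N ->
        exists2 n, dimN N (gen_ideal (g q)) d n & dimN N (gen_ideal (g 0)) d n].

(* The exponent of q is a nonnegative integer, and 0 ^ 0 = 1. Each monomial
   occurs for at most one a, since i + 3 a and i + 1 - 3 b are never equal. *)
Definition brel (q : R[i]) (i : int) : fseries R :=
  infsum (fun (a : int) m =>
    (-1) ^ a * q ^ (a * (3 * a - 1) %/ 2)%Z
      * fmul (fvar (i + 3 * a)) (fvar (i + 1 - 3 * a)) m).

End FormalSums.

(* Main.v *)
(* Order the monomials of a fixed bidegree by the energy sum_i m_i i^2. Whatever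
   q is, x_i x_(i+1) is the term of least energy of the i-th relation, with
   coefficient 1, and the relations form a Groebner basis for this order; so the
   monomials with m_i m_(i+1) = 0 give a basis of the quotient for every q. The
   leading terms of x_(i+2) r_i and x_i r_(i+1) are the only overlapping ones,
   and they cancel in the syzygy
     sum_k (-1)^k q^(k(k+1)/2) x_(i-2k) r_(i+1+k) = 0.
   Linear independence is obtained dually: for every standard monomial s there
   is a linear functional that is dual to s on the standard monomials and
   vanishes on all the multiples of the relations. *)

Require Import Defs.
From mathcomp Require Import all_boot all_order all_algebra.
From mathcomp Require Import finmap complex monalg.
From mathcomp Require Import boolp classical_sets functions cardinality fsbigop.
From mathcomp Require Import reals.
From mathcomp Require Import zify ring.

Set Implicit Arguments.
Unset Strict Implicit.
Unset Printing Implicit Defensive.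

Import Order.TTheory GRing.Theory Num.Theory.

Local Open Scope classical_set_scope.
Local Open Scope ring_scope.
Local Open Scope complex_scope.

(** * Finitely supported sums *)

Section FiniteSums.
Variable K : numFieldType.

Lemma fsbig_finT (I : choiceType) (A : set I) (F : I -> K) :
  (forall i, F i != 0 -> A i) -> \sum_(i \in [set: I]) F i = \sum_(i \in A) F i.
Proof.
move=> FA; apply/esym/fsbig_widen => // i /= [_ nAi].
by apply/eqP/negPn/negP => /FA.
Qed.

Lemma fsbigT_neq0 (I : choiceType) (F : I -> K) :
  \sum_(i \in [set: I]) F i != 0 -> exists i, F i != 0.
Proof.
move=> S0; apply: contrapT => no; move/eqP: S0; apply; apply: fsbig1 => i _.
by apply: contrapT => /eqP Fi; apply: no; exists i.
Qed.

Lemma fsbigT1 (I : choiceType) (i0 : I) (F : I -> K) :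
  (forall i, i != i0 -> F i = 0) -> \sum_(i \in [set: I]) F i = F i0.
Proof.
move=> F0; rewrite (@fsbig_finT _ [set i0]) ?fsbig_set1// => i Fi /=.
by apply/eqP; apply: contraNT Fi => /F0 ->.
Qed.

Lemma fsbigTD1 (I : choiceType) (i0 : I) (A : set I) (F : I -> K) :
  finite_set A -> (forall i, F i != 0 -> A i) ->
  \sum_(i \in [set: I]) F i =
  F i0 + \sum_(i \in [set: I]) (if i == i0 then 0 else F i).
Proof.
move=> finA FA; have finA' : finite_set (A `|` [set i0]).
  by rewrite finite_setU.
rewrite (@fsbig_finT _ (A `|` [set i0])); last by move=> i /FA; left.
rewrite (@fsbig_finT _ (A `|` [set i0]) (fun i => if _ then _ else _));
  last first.
  by move=> i; case: ifP => [_ /eqP//|_ /FA]; left.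
rewrite (fsbigD1 i0)//=; last by right.
rewrite [in RHS](fsbigD1 i0)//=; last by right.
rewrite eqxx add0r; congr (_ + _); apply: eq_fsbigr => i.
by rewrite inE /= => -[_ /eqP/negPf ->].
Qed.

(** A sum with infinite support is 0 by convention, so the interchange needs a finite rectangle
    containing the support. *)
Lemma exchange_fsbigT (I J : choiceType) (A : set I) (B : set J)
    (F : I -> J -> K) :
  finite_set A -> finite_set B -> (forall i j, F i j != 0 -> A i /\ B j) ->
  \sum_(i \in [set: I]) \sum_(j \in [set: J]) F i j =
  \sum_(j \in [set: J]) \sum_(i \in [set: I]) F i j.
Proof.
move=> finA finB FAB.
transitivity (\sum_(i \in A) \sum_(j \in B) F i j).
  rewrite (@fsbig_finT _ A) => [|i /fsbigT_neq0[j /FAB[]]//].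
  by apply: eq_fsbigr => i _; apply: fsbig_finT => j /FAB[].
rewrite exchange_fsbig//.
rewrite [RHS](@fsbig_finT _ B) => [|j /fsbigT_neq0[i /FAB[]]//].
by apply: eq_fsbigr => j _; apply/esym/fsbig_finT => i /FAB[].
Qed.

Lemma pair_fsbigT (I J : choiceType) (A : set I) (B : set J)
    (F : I -> J -> K) :
  finite_set A -> finite_set B -> (forall i j, F i j != 0 -> A i /\ B j) ->
  \sum_(i \in [set: I]) \sum_(j \in [set: J]) F i j =
  \sum_(p \in [set: I * J]) F p.1 p.2.
Proof.
move=> finA finB FAB.
transitivity (\sum_(i \in A) \sum_(j \in B) F i j).
  rewrite (@fsbig_finT _ A) => [|i /fsbigT_neq0[j /FAB[]]//].
  by apply: eq_fsbigr => i _; apply: fsbig_finT => j /FAB[].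
rewrite pair_fsbig//; apply/esym/fsbig_finT => -[i j] /= /FAB.
by [].
Qed.

Lemma fsbigT_split (I : choiceType) (A : set I) (F G : I -> K) :
  finite_set A -> (forall i, F i != 0 -> A i) -> (forall i, G i != 0 -> A i) ->
  \sum_(i \in [set: I]) (F i + G i) =
  \sum_(i \in [set: I]) F i + \sum_(i \in [set: I]) G i.
Proof.
move=> finA FA GA; rewrite (@fsbig_finT _ A) ?fsbig_split//; last first.
  move=> i; apply: contraNP => nA.
  case: (eqVneq (F i) 0) => [->|/FA//]; case: (eqVneq (G i) 0) => [->|/GA//].
  by rewrite addr0.
by rewrite -!(@fsbig_finT _ A).
Qed.

End FiniteSums.

Local Notation "1" := (@mone _) : monom_scope.
Local Notation "x * y" := (mmul x y) : monom_scope.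

Implicit Types (i j : int) (m u v : monom).

(** * Monomials *)

(** Additive on products. The identity weight gives the first component of [bideg], and the squares
    give the energy. *)
Definition weight (w : int -> int) m : int := \sum_(i <- finsupp m) w i *+ m i.

Lemma weightEw w m (A : {fset int}) :
  (finsupp m `<=` A)%fset -> weight w m = \sum_(i <- A) w i *+ m i.
Proof.
move=> sA; rewrite /weight (big_fset_incl _ sA)// => i _.
by rewrite -cmE_eq0 => /eqP ->; rewrite mulr0n.
Qed.

Lemma weightM w u v : weight w (u * v)%M = weight w u + weight w v.
Proof.
rewrite (weightEw w (fsubsetUl (finsupp u) (finsupp v))).
rewrite (weightEw w (fsubsetUr (finsupp u) (finsupp v))).
rewrite {1}/weight mdomD -big_split /=; apply: eq_bigr => i _.
by rewrite cmM mulrnDr.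
Qed.

Lemma weightU w i : weight w (ucm i) = w i.
Proof. by rewrite /weight mdomU big_seq_fset1 cmUU. Qed.

Lemma bidegM u v :
  bideg (u * v)%M = ((bideg u).1 + (bideg v).1, (bideg u).2 + (bideg v).2).
Proof. by rewrite /bideg -!/(weight id _) weightM mdegM. Qed.

Lemma bidegU i : bideg (ucm i) = (i, 1).
Proof. by rewrite /bideg -/(weight id _) weightU mdegU. Qed.

Lemma cmonom_eq m u : (forall i, m i = u i) -> m = u.
Proof. by move=> e; apply/eqP/cmP. Qed.

Lemma cmulAC u v m : (u * v * m = u * m * v)%M.
Proof. by rewrite -mulmA [(v * _)%M]mulmC mulmA. Qed.

Lemma cmulIl m u v : (m * u = m * v)%M -> u = v.
Proof.
move=> e; apply: cmonom_eq => i; apply: (@addnI (m i)).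
by rewrite -!cmM e.
Qed.

Lemma cmulIr m u v : (u * m = v * m)%M -> u = v.
Proof. by rewrite ![(_ * m)%M]mulmC; apply: cmulIl. Qed.

Lemma cm_factor m i : (0 < m i)%N -> exists u, m = (u * ucm i)%M.
Proof.
move=> mi; exists (divcm m (ucm i)); apply: cmonom_eq => j.
rewrite cmM divcmE cmU; case: eqVneq => [<-|_] /=; last by rewrite subn0 addn0.
by rewrite subnK.
Qed.

Lemma monom_ind (P : monom -> Prop) :
  P 1%M -> (forall u i, P u -> P (u * ucm i)%M) -> forall m, P m.
Proof.
move=> P1 PM m; move: {-1}(mdeg m) (erefl (mdeg m)) => n.
elim: n m => [|n IH] m; first by move=> /mdeg_eq0I ->.
case: (pselect (exists i, (0 < m i)%N)) => [[i /cm_factor[u ->]]|no].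
  by rewrite mdegM mdegU addn1 => -[] /IH /PM.
suff -> : m = 1%M by [].
apply: cmonom_eq => i; rewrite cm1; apply/eqP; rewrite -leqn0 leqNgt.
by apply/negP => mi; apply: no; exists i.
Qed.

(** The monomials that fail this are the multiples of the generators of [cutoff N]. *)
Definition bounded_by (N : int) m := forall i, (0 < m i)%N -> i <= N.

Lemma bounded_byM N u v :
  bounded_by N (u * v)%M <-> bounded_by N u /\ bounded_by N v.
Proof.
split=> [b|[bu bv] i]; first by split=> i ui; apply: b; rewrite cmM; lia.
by rewrite cmM addn_gt0 => /orP[/bu|/bv].
Qed.

Lemma bounded_byU N i : bounded_by N (ucm i) <-> i <= N.
Proof.
split=> [b|iN j]; first by apply: b; rewrite cmUU.
by rewrite cmU; case: eqVneq => [<-|].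
Qed.

Lemma weight_bounded N m : bounded_by N m -> weight id m <= N *+ mdeg m.
Proof.
elim/monom_ind: m => [|u i IH].
  by rewrite /weight mdom1 big_seq_fset0 mdeg1.
rewrite bounded_byM bounded_byU => -[/IH bu iN].
by rewrite weightM weightU mdegM mdegU addn1 mulrSr lerD.
Qed.

(** * Finiteness of boxes and of factorisations *)

Definition box (N : int) (d : int * int) : set monom :=
  [set m | bideg m = d /\ bounded_by N m].

Lemma finite_int_itv (a b : int) : finite_set [set i : int | a <= i <= b].
Proof.
apply: (@sub_finite_set _ _ ((fun n : nat => a + n%:Z) @` `I_(`|b - a|.+1))).
  by move=> i /= /andP[ai ib]; exists `|i - a|%N => /=; lia.
exact/finite_image/finite_II.
Qed.

Lemma finite_monoms (A : set int) n : finite_set A ->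
  finite_set [set m : monom | mdeg m = n /\ forall i, (0 < m i)%N -> A i].
Proof.
move=> finA; elim: n => [|n IH].
  apply: (@sub_finite_set _ _ [set 1%M]); last exact: finite_set1.
  by move=> m /= [/mdeg_eq0I].
set S := [set m | _] in IH.
apply: (@sub_finite_set _ _ ((fun p => (p.1 * ucm p.2)%M) @` (S `*` A))).
  move=> m /= [dm Am].
  case: (pselect (exists i, (0 < m i)%N)) => [[i mi]|no].
    have [u mE] := cm_factor mi.
    exists (u, i) => //; split=> /=; last exact: Am.
    split; first by move: dm; rewrite mE mdegM mdegU addn1 => -[].
    by move=> j uj; apply: Am; rewrite mE cmM; lia.
  suff m1 : m = 1%M by rewrite m1 mdeg1 in dm.
  apply: cmonom_eq => i; rewrite cm1; apply/eqP; rewrite -leqn0 leqNgt.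
  by apply/negP => mi; apply: no; exists i.
exact/finite_image/finite_setX.
Qed.

Lemma finite_box N d : finite_set (box N d).
Proof.
case: d => n [l|l]; last first.
  by apply: (@sub_finite_set _ _ set0) => // m /= [[]].
(* [B] bounds the weight of the other [l - 1] factors, whose indices are at most [N]; hence each
   index of [m] is at least [n - B]. *)
pose B := `|N| * l%:Z.
apply: sub_finite_set (finite_monoms l (finite_int_itv (n - B) N)).
move=> m /= [[mn ml] bm]; split=> // i mi; rewrite bm // andbT.
have [u mE] := cm_factor mi; move: bm ml mn.
rewrite -/(weight id _) mE bounded_byM weightM weightU mdegM mdegU.
move=> -[/weight_bounded wu _] ml; rewrite -/B.
have : N *+ mdeg u <= B.
  by rewrite /B -ml -mulr_natr natz; nia.
lia.
Qed.

(** A factorisation of [m x_i] arises from one of [m] by putting [x_i] on the left or on the right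
    factor. *)
Lemma finite_divisors m :
  finite_set [set p : monom * monom | (p.1 * p.2)%M = m].
Proof.
elim/monom_ind: m => [|m i IH].
  apply: (@sub_finite_set _ _ [set (1%M, 1%M)]); last exact: finite_set1.
  by move=> [u v] /= /eqP; rewrite cmM_eq1 => /andP[/eqP -> /eqP ->].
set S := [set p | _] in IH.
pose f p : monom * monom := ((p.1 * ucm i)%M, p.2).
pose g p : monom * monom := (p.1, (p.2 * ucm i)%M).
apply: (@sub_finite_set _ _ ((f @` S) `|` (g @` S))); last first.
  by rewrite finite_setU; split; apply: finite_image.
move=> [u v] /= uv.
have : (0 < u i)%N || (0 < v i)%N.
  by rewrite -addn_gt0 -cmM uv cmM cmUU; lia.
case/orP => /cm_factor[w E]; [left; exists (w, v) | right; exists (u, w)].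
- by apply: (@cmulIr (ucm i)); rewrite -uv E -!mulmA [(v * _)%M]mulmC.
- by rewrite /f /= E.
- by apply: (@cmulIr (ucm i)); rewrite -uv E -!mulmA.
- by rewrite /g /= E.
Qed.

(** The generalized pentagonal numbers are the exponents of [q] in the relations; the triangular
    numbers [tri] are those in the cubic syzygy. *)
Definition pent (a : int) : nat := `|(a * (3 * a - 1) %/ 2)%Z|.
Definition tri (k : int) : nat := `|(k * (k + 1) %/ 2)%Z|.

(** * The relations and their terms *)

Lemma int_parity (a : int) : exists b : int, a = 2 * b \/ a = 2 * b + 1.
Proof.
exists (a %/ 2)%Z; have := divz_eq a 2.
have := modz_ge0 a (isT : 2 != 0 :> int).
have := ltz_pmod a (isT : 0 < 2 :> int).
lia.
Qed.

Lemma absz_half (n b : int) :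
  n = b * 2 -> 0 <= b -> (`|(n %/ 2)%Z|%N)%:Z * 2 = n.
Proof. by move=> -> b0; rewrite mulzK// gez0_abs. Qed.

Lemma pentE (a : int) : (pent a)%:Z * 2 = a * (3 * a - 1).
Proof.
have [b [->|->]] := int_parity a.
- by apply: (@absz_half _ (b * (6 * b - 1))); [ring|nia].
- by apply: (@absz_half _ ((2 * b + 1) * (3 * b + 1)));
  [ring|case: (lerP 0 b); nia].
Qed.

Lemma triE (k : int) : (tri k)%:Z * 2 = k * (k + 1).
Proof.
have [b [->|->]] := int_parity k.
- by apply: (@absz_half _ (b * (2 * b + 1))); [ring|nia].
- by apply: (@absz_half _ ((2 * b + 1) * (b + 1)));
  [ring|case: (lerP 0 b); nia].
Qed.

Definition lead i : monom := (ucm i * ucm (i + 1))%M.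
Definition term i a : monom := (ucm (i + 3 * a) * ucm (i + 1 - 3 * a))%M.

Lemma term0 i : term i 0 = lead i.
Proof. by rewrite /term /lead mulr0 addr0 subr0. Qed.

Definition energy : monom -> int := weight (fun i => i ^+ 2).

Lemma energyM u v : energy (u * v)%M = energy u + energy v.
Proof. exact: weightM. Qed.

(** Moving the indices apart adds [6a(3a - 1)] to the sum of squares: the exponent of [q] is one
    twelfth of the energy excess over the leading term. *)
Lemma energy_term i a : energy (term i a) = energy (lead i) + (pent a)%:Z * 12.
Proof.
rewrite /energy !weightM !weightU.
have := pentE a; nia.
Qed.

Lemma pent_gt0 a : a != 0 -> (0 < pent a)%N.
Proof. by have := pentE a; nia. Qed.

Section Relations.
Variables (K : numFieldType) (q : K).
Implicit Types (phi : monom -> K).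

Definition relcoef (a : int) : K := (-1) ^ a * q ^+ pent a.

Lemma relcoef0 : relcoef 0 = 1.
Proof. by rewrite /relcoef /pent mul0r div0z /= expr0z expr0 mulr1. Qed.

(* The linear extension of phi, evaluated at u times the i-th relation. *)
Definition relsum phi u i : K :=
  \sum_(a \in [set: int]) relcoef a * phi (u * term i a)%M.

Definition fin_supp phi := finite_set [set m | phi m != 0].

Lemma fin_supp_index phi : fin_supp phi ->
  exists B : int, forall m i, phi m != 0 -> (0 < m i)%N -> `|i| <= B.
Proof.
move=> fs.
(* The product of all monomials of the support involves every index that occurs in one of them. *)
pose S := finsupp (\big[mmul/1%M]_(m <- fset_set [set m | phi m != 0]) m).
exists (\sum_(i <- S) `|i|) => m i pm mi.
have iS : i \in S.
  rewrite /S (big_fsetD1 m) /=; last by rewrite in_fset_set// inE.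
  by rewrite -cmE_neq0 cmM addn_eq0 negb_and -lt0n mi.
by rewrite (big_fsetD1 i iS) /= lerDl sumr_ge0.
Qed.

(** The factor [x_(i+3a)] bounds [a] in terms of the indices in the support of [phi], so [relsum] is
    a genuine finite sum. *)
Lemma relsum_supp phi u i : fin_supp phi ->
  exists2 A, finite_set A &
    forall a, relcoef a * phi (u * term i a)%M != 0 -> A a.
Proof.
move=> /fin_supp_index[B phiB].
exists [set a : int | - (B + `|i|) <= a <= B + `|i|].
  exact: finite_int_itv.
move=> a; rewrite mulf_eq0 negb_or => /andP[_ /phiB] /(_ (i + 3 * a)) /=.
rewrite !cmM cmUU => X; have /= := X _; lia.
Qed.

Lemma relsum0 phi u i : fin_supp phi ->
  relsum phi u i = phi (u * lead i)%M +
    \sum_(a \in [set: int])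
      (if a == 0 then 0 else relcoef a * phi (u * term i a)%M).
Proof.
move=> /(relsum_supp u i)[A finA supA].
by rewrite /relsum (fsbigTD1 0 finA supA) relcoef0 mul1r term0.
Qed.

End Relations.

(** * The cubic syzygy *)

(* The index (k, a) stands for the product of x_(i-2k) with the a-th term of the
   relation of index i+1+k. Measured from i+1, two of the three indices of this
   product are odd, one of them being -1-2k; the involution swaps their roles,
   which preserves the product and changes the sign of its coefficient. *)
Definition syz_inv (p : int * int) : int * int :=
  let c := ((p.1 + p.2) %/ 2)%Z in
  if p.1 + p.2 == 2 * c then (2 * p.2 - c - 1, - c)
  else (- (c + 1 + p.2), c + 1 - p.2).

Lemma syz_inv_even (c a : int) : syz_inv (2 * c - a, a) = (2 * a - c - 1, - c).
Proof.
by rewrite /syz_inv /= subrK mulrC mulzK// mulrC eqxx.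
Qed.

Lemma syz_inv_odd (c a : int) :
  syz_inv (2 * c + 1 - a, a) = (- (c + 1 + a), c + 1 - a).
Proof.
rewrite /syz_inv /= subrK mulrC divzMDl// divz_small// addr0 mulrC.
by case: eqP => //; lia.
Qed.

Lemma syz_cases (p : int * int) :
  exists c, p = (2 * c - p.2, p.2) \/ p = (2 * c + 1 - p.2, p.2).
Proof.
case: p => k a /=; have [c [E|E]] := int_parity (k + a); exists c; [left|right].
  by rewrite -E addrK.
by rewrite -E addrK.
Qed.

(** Pairs with even sum go to pairs with odd sum and conversely, so the two branches undo each
    other. *)
Lemma syz_invK : involutive syz_inv.
Proof.
move=> p; have [c [->|->]] := syz_cases p; set a := p.2.
  rewrite syz_inv_even (_ : 2 * a - c - 1 = 2 * (a - c - 1) + 1 - - c); last lia.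
  by rewrite syz_inv_odd; congr (_, _); lia.
rewrite syz_inv_odd (_ : - (c + 1 + a) = 2 * (- a) - (c + 1 - a)); last lia.
by rewrite syz_inv_even; congr (_, _); lia.
Qed.

(** Twelve times either side is the energy of the common product [syz_mon] minus that of
    [x_i x_(i+1) x_(i+2)]. *)
Lemma tri_pent (c a : int) :
  (tri (2 * a - c - 1) + pent (- c) = tri (2 * c - a) + pent a)%N.
Proof.
have := triE (2 * a - c - 1); have := triE (2 * c - a).
have := pentE (- c); have := pentE a.
by move: (tri _) (tri _) (pent _) (pent _); lia.
Qed.

Section Syzygies.
Variables (K : numFieldType) (q : K).
Implicit Types (phi : monom -> K).

Definition syz_coef (k : int) : K := (-1) ^ k * q ^+ tri k.

Definition syz_mon i (p : int * int) : monom :=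
  (ucm (i - 2 * p.1) * term (i + 1 + p.1) p.2)%M.

Lemma signzD (k l : int) : (-1 : K) ^ (k + l) = (-1) ^ k * (-1) ^ l.
Proof. by apply: expfzDr; rewrite oppr_eq0 oner_eq0. Qed.

Lemma signz_even (c : int) : (-1 : K) ^ (2 * c) = 1.
Proof. by rewrite -exprz_exp -exprnP sqrrN expr1n exp1rz. Qed.

Lemma syz_coefN p :
  syz_coef (syz_inv p).1 * relcoef q (syz_inv p).2 =
  - (syz_coef p.1 * relcoef q p.2).
Proof.
(* A pair with odd sum is the image of one with even sum, so its case is the even one read
   backwards. *)
wlog [c ->] : p / exists c, p = (2 * c - p.2, p.2) => [wl|].
  have [c [|E]] := syz_cases p; first by move=> E; apply: wl; exists c.
  rewrite -[in RHS](syz_invK p) (wl (syz_inv p)) ?opprK//; exists (- p.2).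
  by rewrite E syz_inv_odd /=; congr (_, _); lia.
rewrite syz_inv_even /=; set a := p.2.
rewrite /syz_coef /relcoef [LHS]mulrACA [in RHS]mulrACA -!signzD -!exprD.
rewrite tri_pent.
(* The exponent of -1 is odd for the image, while it is [2c] for the original pair. *)
rewrite (_ : 2 * a - c - 1 + - c = 2 * (a - c) + - 1); last lia.
by rewrite subrK signzD !signz_even exprN1 invrN1 !mul1r mulN1r.
Qed.

Lemma syz_mon_inv i p : syz_mon i (syz_inv p) = syz_mon i p.
Proof.
wlog [c ->] : p / exists c, p = (2 * c - p.2, p.2) => [wl|].
  have [c [|E]] := syz_cases p; first by move=> E; apply: wl; exists c.
  rewrite -[in RHS](syz_invK p) (wl (syz_inv p))//; exists (- p.2).
  by rewrite E syz_inv_odd /=; congr (_, _); lia.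
rewrite syz_inv_even /syz_mon /term /=; set a := p.2.
rewrite [RHS]mulmA [RHS]mulmC.
(* The new single factor is the old second factor of the term; the old single factor and the old
   first factor form the new term. *)
have -> : i - 2 * (2 * a - c - 1) = i + 1 + (2 * c - a) + 1 - 3 * a by lia.
have -> : i + 1 + (2 * a - c - 1) + 3 * - c = i - 2 * (2 * c - a) by lia.
by have -> : i + 1 + (2 * a - c - 1) + 1 - 3 * - c =
             i + 1 + (2 * c - a) + 3 * a by lia.
Qed.

Lemma syzygy phi v i : fin_supp phi ->
  \sum_(k \in [set: int])
    syz_coef k * relsum q phi (v * ucm (i - 2 * k))%M (i + 1 + k) = 0.
Proof.
move=> fs.
pose G k a := syz_coef k * relcoef q a * phi (v * syz_mon i (k, a))%M.
transitivity (\sum_(k \in [set: int]) \sum_(a \in [set: int]) G k a).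
  apply: eq_fsbigr => k _; rewrite /relsum mulr_fsumr.
  by apply: eq_fsbigr => a _; rewrite /G mulrA /syz_mon [in RHS]mulmA.
(* The index [i - 2k] bounds [k], and then [i + 1 + k + 3a] bounds [a]. *)
have [B phiB] := fin_supp_index fs.
rewrite (@pair_fsbigT _ _ _ (fun k => - (B + `|i|) <= k <= B + `|i|)
   (fun a => - (B + B + `|i|) <= a <= B + B + `|i| + 1)); first last.
- move=> k a; rewrite mulf_eq0 negb_or => /andP[_ /phiB X].
  have := X (i - 2 * k); have := X (i + 1 + k + 3 * a).
  by rewrite /syz_mon /term !cmM !cmUU /=; lia.
- exact: finite_int_itv.
- exact: finite_int_itv.
(* Reindexing by [syz_inv] turns the sum into its own opposite. *)
set S := \sum_(p \in _) _; suff : S = - S.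
  by move/eqP; rewrite -addr_eq0 -mulr2n mulrn_eq0 /= => /eqP.
rewrite {1}/S (@reindex_fsbigT _ _ _ _ _ syz_inv); last first.
  by exists syz_inv; exact: syz_invK.
rewrite -mulN1r mulr_fsumr; apply: eq_fsbigr => -[k a] _.
by rewrite mulN1r /G -!surjective_pairing syz_mon_inv syz_coefN mulNr.
Qed.

End Syzygies.

(** * Functionals dual to the standard monomials *)

Lemma energy_ge0 m : 0 <= energy m.
Proof. by apply: sumr_ge0 => i _; rewrite mulrn_wge0// sqr_ge0. Qed.

Lemma energy_term_gt u i a :
  a != 0 -> energy (u * lead i)%M < energy (u * term i a)%M.
Proof. by move=> /pent_gt0; rewrite !(energyM u) energy_term; lia. Qed.

Lemma bideg_term i a : bideg (term i a) = bideg (lead i).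
Proof. by rewrite /term /lead !bidegM !bidegU /=; congr (_, _); lia. Qed.

(** The larger index of a term is smallest for [a = 0]. So a relation multiple whose leading
    monomial leaves the box has no term in the box. *)
Lemma box_term N d u i a : box N d (u * term i a)%M -> box N d (u * lead i)%M.
Proof.
rewrite /box /= !(bidegM u) bideg_term => -[-> b]; split=> //; move: b.
rewrite /term /lead !bounded_byM !bounded_byU => -[? [? ?]]; split=> //; lia.
Qed.

Definition standard m := forall i, ~~ ((0 < m i)%N && (0 < m (i + 1)%R)%N).

Lemma lead_nonstandard u i : ~ standard (u * lead i)%M.
Proof. by move=> /(_ i); rewrite /lead !cmM !cmUU; lia. Qed.

Lemma nonstandard_lead m : ~ standard m -> exists p, m = (p.1 * lead p.2)%M.
Proof.
move=> /existsNP[i /negP/negPn/andP[mi]].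
have [u ->] := cm_factor mi.
rewrite cmM cmU (_ : (_ == _) = false) ?addn0; last by apply/eqP; lia.
move=> /cm_factor[v ->]; exists (v, i) => /=.
by rewrite /lead [(ucm i * _)%M]mulmC mulmA.
Qed.

(** A nonstandard monomial may have several leading divisors; one is fixed arbitrarily, and
    [relsum_lead] makes the choice harmless. *)
Lemma lead_choice : {g : monom -> monom * int &
  forall m, ~ standard m -> m = ((g m).1 * lead (g m).2)%M}.
Proof.
apply: (@choice _ _ (fun m p => ~ standard m -> m = (p.1 * lead p.2)%M)) => m.
have [sm|/nonstandard_lead[p mE]] := pselect (standard m); last by exists p.
by exists (1%M, 0).
Qed.

Section Dual.
Variables (K : numFieldType) (q : K).
Implicit Types (phi : monom -> K).

Lemma relsum_eq0 phi u i :
  (forall a, phi (u * term i a)%M = 0) -> relsum q phi u i = 0.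
Proof. by move=> p0; apply: fsbig1 => a _; rewrite p0 mulr0. Qed.

(** In the syzygy, the summands [k = 0] and [k = -1] are the two sides; the leading energy of any
    other one is higher by [6k(k + 1) > 0], so [phi] kills it. *)
Lemma overlap phi v i : fin_supp phi ->
  (forall u j, energy (v * ucm (i + 2) * lead i)%M < energy (u * lead j)%M ->
    relsum q phi u j = 0) ->
  relsum q phi (v * ucm (i + 2))%M i = relsum q phi (v * ucm i)%M (i + 1).
Proof.
move=> fs phi0; have := syzygy q v i fs.
rewrite (@fsbigTE _ _ _ _ [fset 0; -1]%fset); last first.
  move=> k; rewrite !inE negb_or => /andP[k0 k1]; rewrite phi0 ?mulr0//.
  have kk : 0 < k * (k + 1) by nia.
  rewrite !energyM /energy !weightU -subr_gt0.
  by rewrite [X in _ < X](_ : _ = 6 * (k * (k + 1))); [lia|ring].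
rewrite big_fsetU1 ?inE//= big_seq_fset1.
(* Both exponents of [q] are 0, so the two coefficients are 1 and -1. *)
rewrite /syz_coef (_ : tri 0 = 0%N)// (_ : tri (-1) = 0%N)//.
rewrite expr0 expr0z exprN1 invrN1 !mulr1 mul1r mulN1r.
rewrite mulr0 subr0 addr0 mulrN1 opprK addrK.
by move/eqP; rewrite subr_eq0 => /eqP.
Qed.

(** Multiplying the [j]-th relation by a nonleading term of the [i]-th raises the leading energy,
    where [phi] already vanishes. *)
Lemma relsum_product phi v i j : fin_supp phi ->
  (forall u k, energy (v * lead i * lead j)%M < energy (u * lead k)%M ->
    relsum q phi u k = 0) ->
  \sum_(a \in [set: int]) relcoef q a * relsum q phi (v * term i a)%M j =
  relsum q phi (v * lead i)%M j.
Proof.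
move=> fs phi0; rewrite (@fsbigT1 _ _ 0) => [|a a0].
  by rewrite relcoef0 mul1r term0.
rewrite phi0 ?mulr0//.
by rewrite energyM [X in _ < X]energyM ltrD2r energy_term_gt.
Qed.

(* Both sides are the sum of phi over all pairs of terms of the two relations. *)
Lemma disjoint_pair phi v i j : fin_supp phi ->
  (forall u k, energy (v * lead i * lead j)%M < energy (u * lead k)%M ->
    relsum q phi u k = 0) ->
  relsum q phi (v * lead i)%M j = relsum q phi (v * lead j)%M i.
Proof.
move=> fs phi0; rewrite -(relsum_product fs phi0) -relsum_product//; last first.
  by move=> u k; rewrite cmulAC; apply: phi0.
pose F a b := relcoef q a * relcoef q b * phi (v * term i a * term j b)%M.
transitivity (\sum_(a \in [set: int]) \sum_(b \in [set: int]) F a b).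
  apply: eq_fsbigr => a _; rewrite /relsum mulr_fsumr.
  by apply: eq_fsbigr => b _; rewrite mulrA.
have [B phiB] := fin_supp_index fs.
rewrite (@exchange_fsbigT _ _ _ (fun a => - (B + `|i|) <= a <= B + `|i|)
   (fun b => - (B + `|j|) <= b <= B + `|j|)); first last.
- move=> a b; rewrite mulf_eq0 negb_or => /andP[_ /phiB X].
  have := X (i + 3 * a); have := X (j + 3 * b).
  by rewrite /term !cmM !cmUU /=; lia.
- exact: finite_int_itv.
- exact: finite_int_itv.
apply: eq_fsbigr => b _; rewrite /relsum mulr_fsumr.
apply: eq_fsbigr => a _; rewrite /F cmulAC.
by rewrite (mulrC (relcoef q a)) -(mulrA (relcoef q b)).
Qed.

(** This is Buchberger's criterion in dual form: the leading monomials of the two relations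
    coincide, overlap in one variable, or are coprime. *)
Lemma relsum_lead phi u i u' i' : fin_supp phi ->
  (u * lead i = u' * lead i')%M ->
  (forall v j, energy (u * lead i)%M < energy (v * lead j)%M ->
    relsum q phi v j = 0) ->
  relsum q phi u i = relsum q phi u' i'.
Proof.
wlog ii' : u i u' i' / i <= i' => [wl fs E phi0|].
  have [/wl|/ltW/wl wl'] := lerP i i'; first exact.
  by apply/esym/wl' => // v j; rewrite -E; apply: phi0.
move=> fs E phi0.
have Ei k := congr1 (fun m : monom => m k) E.
have [ii|ne] := eqVneq i i'.
  by move: E; rewrite ii => /cmulIr ->.
have [i'E|ne1] := eqVneq i' (i + 1).
  have [v uE] : exists v, u = (v * ucm (i + 2))%M.
    apply: cm_factor; have := Ei (i + 2).
    by rewrite i'E /lead !cmM !cmU; lia.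
  have u'E : u' = (v * ucm i)%M.
    apply: (@cmulIr (lead i')); rewrite -E uE i'E /lead -addrA.
    by rewrite -!mulmA; congr (_ * _)%M; rewrite mulmC -mulmA.
  by rewrite uE u'E i'E; apply: overlap => // w j; rewrite -uE; apply: phi0.
(* Now [i' >= i + 2], so the two leading monomials are coprime. *)
have [v uE] : exists v, u = (v * lead i')%M.
  have [v vE] : exists v, u = (v * ucm i')%M.
    by apply: cm_factor; have := Ei i'; rewrite /lead !cmM !cmU; lia.
  have [w wE] : exists w, v = (w * ucm (i' + 1))%M.
    apply: cm_factor; have := Ei (i' + 1).
    by rewrite vE /lead !cmM !cmU; lia.
  by exists w; rewrite vE wE /lead [(ucm i' * _)%M]mulmC mulmA.
have u'E : u' = (v * lead i)%M.
  by apply: (@cmulIr (lead i')); rewrite -E uE cmulAC.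
rewrite uE u'E; apply: disjoint_pair => // w j; rewrite -uE; apply: phi0.
Qed.

(** * Construction of the dual functionals *)

Lemma energy_box N d : exists H, forall m, box N d m -> energy m <= H.
Proof.
exists (\sum_(m <- fset_set (box N d)) energy m) => m bm.
rewrite (big_fsetD1 m) /=; last first.
  by rewrite in_fset_set ?inE//; exact: finite_box.
by rewrite lerDl sumr_ge0// => u _; exact: energy_ge0.
Qed.

(** Start from the indicator of [s] and descend in energy, at each level resetting the values on
    nonstandard monomials so that the relations led by them are killed. *)
Lemma dual_exists N d s : box N d s -> standard s ->
  exists phi, [/\ forall m, phi m != 0 -> box N d m,
    forall m, box N d m -> standard m -> phi m = (m == s)%:R
    & forall u i, relsum q phi u i = 0].
Proof.
move=> bs ss; have [H leH] := energy_box N d.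
(* [n] counts the energy levels treated, from [H] downwards; energies being nonnegative, [H + 1]
   levels exhaust them. *)
suff dual n : exists phi, [/\ forall m, phi m != 0 -> box N d m,
    forall m, box N d m -> standard m -> phi m = (m == s)%:R
    & forall u i, H < energy (u * lead i)%M + n%:Z -> relsum q phi u i = 0].
  have [phi [? ? phi0]] := dual `|H|.+1; exists phi; split=> // u i.
  by apply: phi0; have := energy_ge0 (u * lead i)%M; lia.
elim: n => [|n [phi [phib phis phi0]]].
  (* Every term of a relation multiple led above [H] has energy above [H], hence differs from
     [s]. *)
  exists (fun m => (m == s)%:R); split=> // [m|u i Hui].
    by have [->//|_] := eqVneq m s; rewrite eqxx.
  apply: relsum_eq0 => a; case: eqVneq => // E.
  have := leH _ bs; rewrite -E; have [a0|a0] := eqVneq a 0.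
    by rewrite a0 term0; lia.
  by have := energy_term_gt u i a0; lia.
have [g gE] := lead_choice.
(* The nonleading terms lie at higher energy, where [phi] is final; the new value on the leading
   monomial must cancel their contribution. *)
pose tail p := \sum_(a \in [set: int])
  (if a == 0 then 0 else relcoef q a * phi (p.1 * term p.2 a)%M).
pose level m := [/\ energy m = H - n%:Z, box N d m & ~ standard m].
pose phi' m := if `[< level m >] then - tail (g m) else phi m.
have phi'E m : energy m != H - n%:Z -> phi' m = phi m.
  by move=> /eqP ne; rewrite /phi'; case: asboolP => // -[].
have phi'b m : phi' m != 0 -> box N d m.
  by rewrite /phi'; case: asboolP => [[]//|_]; exact: phib.
have fs : fin_supp phi' by apply: sub_finite_set (finite_box N d).
(* Only values at energy [H - n] change, so relations led above that level stay killed. *)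
have above u i : H - n%:Z < energy (u * lead i)%M -> relsum q phi' u i = 0.
  move=> Hui; rewrite -[RHS](phi0 u i); last by lia.
  apply: eq_fsbigr => a _; rewrite phi'E//.
  have [->|a0] := eqVneq a 0; first by rewrite term0; lia.
  by have := energy_term_gt u i a0; lia.
exists phi'; split=> // [m bm sm|u i Hui].
  by rewrite /phi'; case: asboolP => [[]//|_]; exact: phis.
have [E|ne] := eqVneq (energy (u * lead i)%M) (H - n%:Z); last first.
  by apply: above; lia.
have [bui|nb] := pselect (box N d (u * lead i)%M); last first.
  apply: relsum_eq0 => a; apply: contrapT => /eqP/phi'b/box_term.
  exact: nb.
have uiE := gE _ (@lead_nonstandard u i).
(* The value depends only on the leading monomial, so [u] and [i] may be replaced by the chosen
   factorisation, for which [phi'] was designed. *)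
rewrite (relsum_lead fs uiE); last by rewrite E.
set p := g _ in uiE *.
rewrite relsum0// -uiE {1}/phi'; case: asboolP => [_|[]]; last first.
  by split=> //; exact: lead_nonstandard.
rewrite -/p addrC; apply/eqP; rewrite subr_eq0; apply/eqP.
apply: eq_fsbigr => a _; case: eqVneq => // a0; rewrite phi'E//.
by have := energy_term_gt p.1 p.2 a0; rewrite -uiE E; lia.
Qed.

End Dual.

(** * Formal series and their pairing with functionals *)

Section FormalSeries.
Variable R : realType.
Local Notation C := R[i].
Implicit Types (f g h : fseries R) (phi : monom -> C) (q : C).

Lemma fmul_fmono u g v : fmul (fmono R u) g (u * v)%M = g v.
Proof.
rewrite /fmul -(@fsbig_widen _ _ _ _ [set (u, v)]).
- by rewrite fsbig_set1 /fmono eqxx mul1r.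
- by move=> _ ->.
- move=> [a b] /= [ab ne]; rewrite /fmono.
  case: eqVneq => [au|]; last by rewrite mul0r.
  by case: ne; move: ab; rewrite au => /cmulIl ->.
Qed.

Lemma fmul_fmono_neq0 u g m :
  fmul (fmono R u) g m != 0 -> exists2 v, m = (u * v)%M & g v != 0.
Proof.
move=> nz; have [v mE] : exists v, m = (u * v)%M.
  apply: contrapT => no; move/eqP: nz; apply; apply: fsbig1 => -[a b] /= ab.
  rewrite /fmono; case: eqVneq => [au|]; last by rewrite mul0r.
  by case: no; exists b; rewrite -ab au.
by exists v => //; move: nz; rewrite mE fmul_fmono.
Qed.

Lemma fmulC f g : fmul f g = fmul g f.
Proof.
apply/funext => m; pose swap (p : monom * monom) := (p.2, p.1).
rewrite /fmul (@reindex_fsbig _ _ _ _ _ swap [set p | (p.1 * p.2)%M = m]).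
  by apply: eq_fsbigr => p _; rewrite mulrC.
split.
- by move=> p /= <-; rewrite mulmC.
- by move=> [a b] [a' b'] _ _ [-> ->].
- by move=> [a b] /= ab; exists (b, a) => //=; rewrite mulmC.
Qed.

Lemma fmul_fmonoM u v : fmul (fmono R u) (fmono R v) = fmono R (u * v)%M.
Proof.
apply/funext => m; rewrite {3}/fmono; case: eqVneq => [->|ne].
  by rewrite fmul_fmono /fmono eqxx.
apply: contrapT => /eqP/fmul_fmono_neq0[w mE]; rewrite /fmono.
by case: (eqVneq w v) => [wv _|_]; [rewrite mE wv eqxx in ne|rewrite eqxx].
Qed.

Lemma brelE q i m :
  brel q i m = \sum_(a \in [set: int]) relcoef q a * (m == term i a)%:R.
Proof.
apply: eq_fsbigr => a _; rewrite /fvar fmul_fmonoM /relcoef.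
(* With a nonnegative exponent the integer power of [q] is the natural one. *)
have : 0 <= (a * (3 * a - 1) %/ 2)%Z.
  have := pentE a; rewrite /pent; have := int_parity a => -[b Eb].
  by rewrite divz_ge0//; case: Eb => ->; case: (lerP 0 b); nia.
by rewrite /pent; case: (_ %/ _)%Z.
Qed.

(** Energy recovers the pentagonal number, and [pent] is injective because [3(a + b) - 1] never
    vanishes on integers. *)
Lemma term_inj i : injective (term i).
Proof.
move=> a b /(congr1 energy); rewrite (energy_term i a) (energy_term i b) => e.
have : (pent a)%:Z = pent b by lia.
have := pentE a; have := pentE b => eb ea ab; rewrite ab in ea.
suff : (a - b) * (3 * (a + b) - 1) = 0 by move/eqP; rewrite mulf_eq0; lia.
rewrite (_ : _ * _ = a * (3 * a - 1) - b * (3 * b - 1)); last by ring.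
by rewrite -ea -eb subrr.
Qed.

Lemma brel_term q i a : brel q i (term i a) = relcoef q a.
Proof.
rewrite brelE (@fsbigT1 _ _ a) ?eqxx ?mulr1// => b.
by case: (eqVneq (term i a) (term i b)) => [/term_inj ->|];
  rewrite ?eqxx ?mulr0.
Qed.

Lemma brel_neq0 q i m : brel q i m != 0 -> exists a, m = term i a.
Proof.
rewrite brelE => /fsbigT_neq0[a].
case: (eqVneq m (term i a)) => [->|]; first by exists a.
by rewrite mulr0 eqxx.
Qed.

Lemma brel_component q i : component (2 * i + 1, 2) (brel q i).
Proof.
move=> m /brel_neq0[a ->].
by rewrite bideg_term /lead bidegM !bidegU /=; congr (_, _); lia.
Qed.

Lemma brel0 i : brel (0 : C) i = fmono R (lead i).
Proof.
apply/funext => m; rewrite brelE (@fsbigT1 _ _ 0) => [|a /pent_gt0 a0].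
  by rewrite relcoef0 mul1r term0.
by rewrite /relcoef expr0n -leqn0 leqNgt a0 mulr0 mul0r.
Qed.

Definition pairing phi f : C := \sum_(m \in [set: monom]) f m * phi m.

(** The finitely many monomials in the support of [phi] each occur in finitely many summands. *)
Lemma pairing_infsum phi (I : choiceType) (F : I -> fseries R) :
  fin_supp phi -> summable F ->
  pairing phi (infsum F) = \sum_(k \in [set: I]) pairing phi (F k).
Proof.
move=> fs sumF; rewrite /pairing /infsum.
rewrite -(@exchange_fsbigT _ _ _ [set m | phi m != 0]
  (\bigcup_(m in [set m | phi m != 0]) [set k | F k m != 0])) //.
- by apply: eq_fsbigr => m _; rewrite mulr_fsuml.
- by apply: bigcup_finite => // m _; exact: sumF.
- move=> m k; rewrite mulf_eq0 negb_or => /andP[Fkm pm]; split=> //.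
  by exists m.
Qed.

Lemma pairing_fmul phi f g : fin_supp phi ->
  pairing phi (fmul f g) =
  \sum_(u \in [set: monom]) f u * pairing (fun v => phi (u * v)%M) g.
Proof.
(* Only the factorisations of monomials in the support of [phi] contribute, and they are finitely
   many. *)
move=> fs; pose S := \bigcup_(m in [set m | phi m != 0])
  [set p : monom * monom | (p.1 * p.2)%M = m].
have finS : finite_set S.
  by apply: bigcup_finite => // m _; exact: finite_divisors.
pose G (p : monom * monom) := f p.1 * g p.2 * phi (p.1 * p.2)%M.
have GS p : G p != 0 -> S p.
  by rewrite /G mulf_eq0 negb_or => /andP[_ pp]; exists (p.1 * p.2)%M.
transitivity (\sum_(p \in [set: monom * monom]) G p); last first.
  pose H u v := G (u, v).
  transitivity (\sum_(u \in [set: monom]) \sum_(v \in [set: monom]) H u v).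
    rewrite (@pair_fsbigT _ _ _ (fst @` S) (snd @` S)) //.
    - exact: finite_image.
    - exact: finite_image.
    - by move=> u v /GS uvS; split; exists (u, v).
  apply: eq_fsbigr => u _; rewrite /pairing mulr_fsumr.
  by apply: eq_fsbigr => v _; rewrite /H /G mulrA.
pose F m p := if (p.1 * p.2)%M == m then G p else 0.
transitivity (\sum_(m \in [set: monom])
  \sum_(p \in [set: monom * monom]) F m p).
  apply: eq_fsbigr => m _; rewrite /fmul fsbig_mkcond mulr_fsuml.
  apply: eq_fsbigr => p _; rewrite /patch /F /G.
  case: ifPn => [|]; first by rewrite inE /= => ->; rewrite eqxx.
  by case: eqP => [pm|]; rewrite ?mul0r// notin_setE.
rewrite (@exchange_fsbigT _ _ _ [set m | phi m != 0] S) //.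
  apply: eq_fsbigr => p _; rewrite (@fsbigT1 _ _ (p.1 * p.2)%M) /F ?eqxx// => m.
  by rewrite eq_sym => /negPf ->.
move=> m p; rewrite /F; case: ((p.1 * p.2)%M =P m) => [pm|]; last first.
  by rewrite eqxx.
move=> Gp; split; last exact: GS.
by move: Gp; rewrite /G pm mulf_eq0 negb_or => /andP[].
Qed.

Lemma fin_supp_translate phi u :
  fin_supp phi -> fin_supp (fun v => phi (u * v)%M).
Proof.
move=> fs; rewrite /fin_supp.
rewrite (_ : [set v | _] = mmul u @^-1` [set m | phi m != 0])//.
by apply: finite_preimage fs => v w _ _; exact: cmulIl.
Qed.

Lemma pairing_fmono phi u : pairing phi (fmono R u) = phi u.
Proof.
rewrite /pairing (@fsbigT1 _ _ u); first by rewrite /fmono eqxx mul1r.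
by move=> m /negPf ne; rewrite /fmono ne mul0r.
Qed.

Lemma pairing_brel phi q u i : fin_supp phi ->
  pairing (fun v => phi (u * v)%M) (brel q i) = relsum q phi u i.
Proof.
move=> fs; have [A finA supA] := relsum_supp q u i fs.
pose F v a := relcoef q a * (v == term i a)%:R * phi (u * v)%M.
transitivity (\sum_(v \in [set: monom]) \sum_(a \in [set: int]) F v a).
  by apply: eq_fsbigr => v _; rewrite brelE mulr_fsuml.
rewrite (@exchange_fsbigT _ _ _ [set v | phi (u * v)%M != 0] A) //.
- apply: eq_fsbigr => a _; rewrite (@fsbigT1 _ _ (term i a)) /F ?eqxx ?mulr1//.
  by move=> v /negPf ->; rewrite mulr0 mul0r.
- exact: fin_supp_translate.
- move=> v a; rewrite /F; case: (v =P term i a) => [->|_]; last first.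
    by rewrite mulr0 mul0r eqxx.
  rewrite mulr1 => nz; split; last exact: supA.
  by move: nz; rewrite mulf_eq0 negb_or => /andP[].
Qed.

(** Pairing commutes with the infinite sums, so testing monomial multiples of the generators
    suffices. *)
Lemma pairing_gen_ideal phi (I : choiceType) (g : I -> fseries R) f :
  fin_supp phi ->
  (forall u (k : I), pairing (fun v => phi (u * v)%M) (g k) = 0) ->
  gen_ideal g f -> pairing phi f = 0.
Proof.
move=> fs phi0 [_ [p [_ sum_p ->]]]; rewrite pairing_infsum//.
apply: fsbig1 => k _; rewrite pairing_fmul//; apply: fsbig1 => u _.
by rewrite phi0 mulr0.
Qed.

End FormalSeries.

(** * The quotients *)

Section Ideals.
Variable R : realType.
Local Notation C := R[i].
Implicit Types (f g h : fseries R) (phi : monom -> C) (q : C).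

Lemma algA_component d f : component d f -> algA f.
Proof. by move=> df; exists [:: d] => m /df ->; rewrite inE. Qed.

Lemma fmul_linl f f' g (a : C) m :
  fmul (fun u => f u + a * f' u) g m = fmul f g m + a * fmul f' g m.
Proof.
rewrite /fmul mulr_fsumr -fsbig_split//=; last exact: finite_divisors.
by apply: eq_fsbigr => p _; rewrite mulrDl mulrA.
Qed.

Lemma gen_ideal_lin (I : choiceType) (g : I -> fseries R) f f' (a : C) :
  gen_ideal g f -> gen_ideal g f' -> gen_ideal g (fun m => f m + a * f' m).
Proof.
have lin0 (x y : C) : x + a * y != 0 -> x != 0 \/ y != 0.
  have [->|] := eqVneq x 0; last by left.
  by have [->|] := eqVneq y 0; [rewrite mulr0 addr0 eqxx|right].
have algA_lin h h' : algA h -> algA h' -> algA (fun m => h m + a * h' m).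
  move=> [s sh] [s' sh']; exists (s ++ s') => m /lin0[/sh|/sh'] ms.
    by rewrite mem_cat ms.
  by rewrite mem_cat ms orbT.
move=> [Af [p [Ap sp fE]]] [Af' [p' [Ap' sp' fE']]].
split; first exact: algA_lin.
have fin m : finite_set ([set k | fmul (p k) (g k) m != 0] `|`
    [set k | fmul (p' k) (g k) m != 0]).
  by rewrite finite_setU; split; [exact: sp|exact: sp'].
exists (fun k m => p k m + a * p' k m); split.
- by move=> k; exact: algA_lin.
- move=> m; apply: sub_finite_set (fin m) => k /=.
  by rewrite fmul_linl => /lin0.
- apply/funext => m; rewrite fE fE' /infsum mulr_fsumr.
  rewrite -(fsbigT_split (fin m)).
  + by apply: eq_fsbigr => k _; rewrite fmul_linl.
  + by move=> k; left.
  + by move=> k; rewrite mulf_eq0 negb_or => /andP[_]; right.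
Qed.

Lemma gen_ideal0 (I : choiceType) (g : I -> fseries R) : gen_ideal g (fun=> 0).
Proof.
have fmul0 h m : fmul (fun=> 0) h m = 0.
  by apply: fsbig1 => p _; rewrite mul0r.
have A0 : algA (fun=> 0 : C) by exists [::] => m; rewrite eqxx.
split=> //; exists (fun _ _ => 0); split; first by [].
- by move=> m; apply: (@sub_finite_set _ _ set0) => // k /=; rewrite fmul0 eqxx.
- by apply/funext => m; rewrite /infsum fsbig1.
Qed.

Lemma gen_ideal_fmono (I : choiceType) (g : I -> fseries R) u (k : I) :
  homogeneous (g k) -> gen_ideal g (fmul (fmono R u) (g k)).
Proof.
move=> [d gd]; split.
  apply: (@algA_component ((bideg u).1 + d.1, (bideg u).2 + d.2)).
  by move=> m /fmul_fmono_neq0[v -> /gd <-]; rewrite bidegM.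
pose p l : fseries R := if l == k then fmono R u else fun=> 0.
have p0 l m : l != k -> fmul (p l) (g l) m = 0.
  by move=> /negPf lk; apply: fsbig1 => w _; rewrite /p lk mul0r.
exists p; split.
- move=> l; rewrite /p; case: eqP => _; last by exists [::] => m; rewrite eqxx.
  apply: (@algA_component (bideg u)) => m; rewrite /fmono.
  by have [->|_] := eqVneq m u; rewrite ?eqxx.
- move=> m; apply: (@sub_finite_set _ _ [set k]); last exact: finite_set1.
  by move=> l /= nz; apply/eqP; apply: contraNT nz => /p0 ->.
- apply/funext => m; rewrite /infsum (@fsbigT1 _ _ k) => [|l /p0 ->//].
  by rewrite /p eqxx.
Qed.

(** Each monomial of [f] has a variable beyond [N]; choosing one for each monomial splits [f] into
    disjoint multiples of these variables. *)
Lemma cutoff_vanish N d f : component d f -> (forall m, box N d m -> f m = 0) ->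
  @cutoff R N f.
Proof.
move=> df f0; split; first exact: algA_component df.
have [j jP] : {j : monom -> nat &
    forall m, ~ bounded_by N m -> (0 < m (N + (j m).+1%:Z)%R)%N}.
  apply: (@choice _ _ (fun m (k : nat) =>
    ~ bounded_by N m -> (0 < m (N + k.+1%:Z)%R)%N)) => m.
  have [bm|/existsNP[i /not_implyP[mi /negP iN]]] := pselect (bounded_by N m).
    by exists 0%N.
  by exists `|(i - N - 1)%R|%N => _; rewrite (_ : N + _ = i)//; lia.
pose x k : monom := ucm (N + k.+1%:Z).
(* [p k] gathers the monomials of [f] assigned to the [k]-th variable, divided by it. *)
pose p k u := if j (u * x k)%M == k then f (u * x k)%M else 0.
have fmulp k u : fmul (p k) (fvar R (N + k.+1%:Z)) (u * x k)%M = p k u.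
  by rewrite fmulC mulmC fmul_fmono.
have fmulp_neq0 k m : fmul (p k) (fvar R (N + k.+1%:Z)) m != 0 ->
    j m = k /\ ~ bounded_by N m.
  rewrite fmulC => /fmul_fmono_neq0[u ->].
  rewrite /p -/(x k) mulmC; case: (j _ =P k) => [-> _|_]; last by rewrite eqxx.
  by split=> // /bounded_byM[/bounded_byU + _]; lia.
exists p; split.
- move=> k; apply: (@algA_component (d.1 - (N + k.+1%:Z), d.2 - 1)) => u.
  rewrite /p; case: (j _ =P k) => _; last by rewrite eqxx.
  by move=> /df <-; rewrite bidegM bidegU /= !addrK.
- move=> m; apply: (@sub_finite_set _ _ [set j m]); last exact: finite_set1.
  by move=> k /= /fmulp_neq0[].
- apply/funext => m; rewrite /infsum.
  rewrite (@fsbigT1 _ _ (j m)) => [|k /eqP kj]; last first.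
    by apply: contrapT => /eqP/fmulp_neq0[/esym].
  have [bm|nb] := pselect (bounded_by N m).
    transitivity (0 : C).
      apply: contrapT => /eqP fm; move/eqP: (fm); apply; apply: f0.
      by split=> //; exact: df.
    by apply: contrapT => /nesym/eqP/fmulp_neq0[].
  have [u mE] := cm_factor (jP m nb).
  rewrite -/(x (j m)) in mE.
  by have := fmulp (j m) u; rewrite /p -mE eqxx => ->.
Qed.

(** * Spanning by the standard monomials *)

Definition std_box (N : int) d : seq monom :=
  [seq m <- fset_set (box N d) | `[< standard m >]].

Lemma mem_std_box N d m : m \in std_box N d <-> box N d m /\ standard m.
Proof.
rewrite mem_filter in_fset_set; last exact: finite_box.
by split=> [/andP[/asboolP ? /set_mem]|[/mem_set ? /asboolP ?]] //; apply/andP.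
Qed.

Lemma std_box_uniq N d : uniq (std_box N d).
Proof. by rewrite filter_uniq ?fset_uniq. Qed.

Definition rel_ideal q N : set (fseries R) :=
  add_ideal (gen_ideal (brel q)) (@cutoff R N).

Lemma brel_homogeneous q i : homogeneous (brel q i).
Proof. by eexists; exact: brel_component. Qed.

Lemma rel_ideal_lin q N f f' (a : C) : rel_ideal q N f -> rel_ideal q N f' ->
  rel_ideal q N (fun m => f m + a * f' m).
Proof.
move=> [g Jg [h Kh <-]] [g' Jg' [h' Kh' <-]].
exists (fun m => g m + a * g' m); first exact: gen_ideal_lin.
exists (fun m => h m + a * h' m); first exact: gen_ideal_lin.
by apply/funext => m /=; rewrite mulrDr addrACA.
Qed.

Lemma rel_ideal_rel q N u i : rel_ideal q N (fmul (fmono R u) (brel q i)).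
Proof.
exists (fmul (fmono R u) (brel q i)).
  by apply: gen_ideal_fmono; exact: brel_homogeneous.
exists (fun=> 0); first exact: gen_ideal0.
by apply/funext => m /=; rewrite addr0.
Qed.

Lemma rel_ideal_cutoff q N f : @cutoff R N f -> rel_ideal q N f.
Proof.
move=> Kf; exists (fun=> 0); first exact: gen_ideal0.
by exists f => //; apply/funext => m /=; rewrite add0r.
Qed.

Lemma rel_ideal_sum q N (r : seq monom) (a : monom -> C)
    (F : monom -> fseries R) :
  (forall m, rel_ideal q N (F m)) ->
  rel_ideal q N (fun m => \sum_(w <- r) a w * F w m).
Proof.
move=> WF; elim: r => [|w r IH].
  rewrite (_ : (fun _ => _) = fun=> 0); last first.
    by apply/funext => m; rewrite big_nil.
  exact/rel_ideal_cutoff/gen_ideal0.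
rewrite (_ : (fun _ => _) = fun m => \sum_(w <- r) a w * F w m + a w * F w m).
  exact: rel_ideal_lin.
by apply/funext => m; rewrite big_cons addrC.
Qed.

Lemma sum_fmono (r : seq monom) (a : monom -> C) m : uniq r ->
  \sum_(w <- r) a w * fmono R w m = if m \in r then a m else 0.
Proof.
move=> ur; case: ifPn => mr.
  rewrite (bigD1_seq m)//= big1 => [|w /negPf wm].
    by rewrite /fmono eqxx mulr1 addr0.
  by rewrite /fmono eq_sym wm mulr0.
rewrite big_seq big1// => w wr; rewrite /fmono.
by case: eqP => [mw|]; rewrite ?mulr0//; rewrite mw wr in mr.
Qed.

Lemma rel_value u i q m : fmul (fmono R u) (brel q i) m != 0 ->
  m = (u * lead i)%M \/ energy (u * lead i)%M < energy m.
Proof.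
move=> /fmul_fmono_neq0[v -> /brel_neq0[a ->]].
have [->|a0] := eqVneq a 0; first by left; rewrite term0.
by right; exact: energy_term_gt.
Qed.

Lemma rel_lead u i q : fmul (fmono R u) (brel q i) (u * lead i)%M = 1.
Proof. by rewrite fmul_fmono -term0 brel_term relcoef0. Qed.

(** Reduction runs upwards in energy: subtracting relation multiples clears the lowest nonstandard
    level and creates only monomials of higher energy, which the box bounds. *)
Lemma std_span q N d f : component d f -> exists c : monom -> C,
  rel_ideal q N (fun m => f m - \sum_(s <- std_box N d) c s * fmono R s m).
Proof.
have [H leH] := energy_box N d.
have [g gE] := lead_choice.
suff span n f' : component d f' ->
    (forall m, box N d m -> ~ standard m -> f' m != 0 ->
      H < energy m + n%:Z) ->
    exists c : monom -> C,
    rel_ideal q N (fun m => f' m - \sum_(s <- std_box N d) c s * fmono R s m).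
  move=> df; apply: (span `|H|.+1) => // m _ _ _.
  by have := energy_ge0 m; lia.
elim: n f' => [|n IH] {}f df f0.
  (* No nonstandard monomial of the box is left, so removing the standard part of [f] leaves an
     element of the cutoff ideal. *)
  exists f; apply: rel_ideal_cutoff; apply: (@cutoff_vanish N d).
    move=> m; rewrite sum_fmono ?std_box_uniq//.
    by case: ifP => _; rewrite ?subrr ?subr0 ?eqxx//; exact: df.
  move=> m bm; rewrite sum_fmono ?std_box_uniq//.
  case: ifPn => [_|/negP ns]; first by rewrite subrr.
  rewrite subr0; apply: contrapT => /eqP fm.
  have : H < energy m + 0%:Z.
    by apply: f0 => // sm; apply: ns; apply/mem_std_box.
  by have := leH m bm; lia.
pose F w := fmul (fmono R (g w).1) (brel q (g w).2).
pose level m := [/\ box N d m, ~ standard m & energy m = H - n%:Z].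
pose L := [seq m <- fset_set (box N d) | `[< level m >]].
have LP m : m \in L -> level m by rewrite mem_filter => /andP[/asboolP].
have uL : uniq L by rewrite filter_uniq ?fset_uniq.
pose f' m := f m - \sum_(w <- L) f w * F w m.
have [||c Wc] := IH f'.
- move=> m f'm.
  have [fm|] := eqVneq (f m) 0; last exact: df.
  have [w wL Fw] : exists2 w, w \in L & F w m != 0.
    apply: contrapT => no; move/eqP: f'm; apply.
    rewrite /f' fm big_seq big1 ?subrr// => w wL.
    suff -> : F w m = 0 by rewrite mulr0.
    by apply: contrapT => /eqP ?; apply: no; exists w.
  have [[<- _] nsw _] := LP w wL.
  move: Fw => /fmul_fmono_neq0[v -> /brel_component vE].
  rewrite [in RHS](gE w nsw) bidegM [in RHS]bidegM vE.
  by rewrite /lead bidegM !bidegU /=; congr (_, _); lia.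
- move=> m bm nsm f'm; case: (ltrP H (energy m + n%:Z)) => // Hm.
  move/eqP: f'm; case.
  have [Em|Em] := eqVneq (energy m) (H - n%:Z).
    have mL : m \in L.
      rewrite mem_filter in_fset_set; last exact: finite_box.
      by apply/andP; split; [exact/asboolP|exact: mem_set].
    (* At this level only the multiple led by [m] itself, with coefficient 1, contributes to the
       coefficient of [m]. *)
    rewrite /f' (bigD1_seq m)//= big_seq_cond big1 => [|w /andP[wL wm]].
      by rewrite /F [X in fmul _ _ X](gE m nsm) rel_lead mulr1 addr0 subrr.
    suff -> : F w m = 0 by rewrite mulr0.
    have [_ nsw Ew] := LP w wL.
    apply: contrapT => /eqP/rel_value; rewrite -(gE w nsw) => -[mw|].
      by rewrite mw eqxx in wm.
    by rewrite Ew Em ltxx.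
  (* Below the level, [f] already vanishes on nonstandard monomials of the box and the subtracted
     multiples have no terms. *)
  have fm : f m = 0.
    by apply: contrapT => /eqP/(f0 m bm nsm); lia.
  rewrite /f' fm big_seq big1 ?subrr// => w wL.
  suff -> : F w m = 0 by rewrite mulr0.
  have [_ nsw Ew] := LP w wL.
  apply: contrapT => /eqP/rel_value; rewrite -(gE w nsw) => -[mw|].
    by move: Em; rewrite mw Ew eqxx.
  by rewrite Ew; lia.
exists c.
rewrite (_ : (fun _ => _) = fun m =>
  f' m - \sum_(s <- std_box N d) c s * fmono R s m +
  1 * \sum_(w <- L) f w * F w m).
  apply: rel_ideal_lin => //; apply: rel_ideal_sum => w; exact: rel_ideal_rel.
by apply/funext => m; rewrite /f' mul1r addrAC subrK.
Qed.

(** * Linear independence and the dimension *)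

Lemma pairingE phi f : fin_supp phi ->
  pairing phi f = \sum_(m <- fset_set [set m | phi m != 0]) f m * phi m.
Proof.
move=> fs; apply: fsbigTE => m; rewrite in_fset_set// notin_setE /= => /negP.
by rewrite negbK => /eqP ->; rewrite mulr0.
Qed.

(** The relations are killed by assumption, and the cutoff ideal because [phi] is supported on
    monomials bounded by [N]. *)
Lemma pairing_rel_ideal phi q N d f : (forall m, phi m != 0 -> box N d m) ->
  (forall u i, relsum q phi u i = 0) -> rel_ideal q N f -> pairing phi f = 0.
Proof.
move=> phib phi0.
have fs : fin_supp phi by apply: sub_finite_set (finite_box N d).
move=> [g Jg [h Kh <-]]; rewrite pairingE//.
under eq_bigr do rewrite mulrDl.
rewrite big_split /= -!pairingE//.
rewrite (pairing_gen_ideal fs _ Jg) => [|u i]; last by rewrite pairing_brel.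
rewrite (pairing_gen_ideal fs _ Kh) ?addr0// => u k.
rewrite pairing_fmono; apply: contrapT => /eqP/phib[_].
by rewrite bounded_byM bounded_byU => -[_]; lia.
Qed.

Lemma dimN_brel q N d : dimN N (gen_ideal (brel q)) d (size (std_box N d)).
Proof.
set S := std_box N d; pose b (j : 'I_(size S)) := nth 1%M S j.
have bS (j : 'I_(size S)) : b j \in S by exact: mem_nth.
have coord (j : 'I_(size S)) : {phi : monom -> C |
    [/\ forall m, phi m != 0 -> box N d m,
    forall m, box N d m -> standard m -> phi m = (m == b j)%:R
    & forall u i, relsum q phi u i = 0]}.
  apply: cid; have /mem_std_box[bj sj] := bS j; exact: dual_exists.
exists (fun j : 'I_(size S) => fmono R (b j)); split=> [j m|f df].
  rewrite /fmono; case: (m =P b j) => [-> _|_]; last by rewrite eqxx.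
  by have /mem_std_box[[]] := bS j.
(* The functional dual to [b j] reads off the [j]-th coordinate, which gives uniqueness. *)
have cE (c : 'rV[C]_(size S)) (j : 'I_(size S)) :
    rel_ideal q N (fun m => f m - \sum_(i < size S) c 0 i * fmono R (b i) m) ->
    c 0 j = pairing (sval (coord j)) f.
  case: (coord j) => phi /= [phib phis phi0] /(pairing_rel_ideal phib phi0).
  have fs : fin_supp phi by apply: sub_finite_set (finite_box N d).
  rewrite pairingE//; under eq_bigr do rewrite mulrBl mulr_suml.
  rewrite sumrB -pairingE// exchange_big /=.
  move=> /eqP; rewrite subr_eq0 => /eqP ->.
  have val (i : 'I_(size S)) :
      \sum_(m <- fset_set [set m | phi m != 0])
        c 0 i * fmono R (b i) m * phi m =
      c 0 i * (i == j)%:R.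
    under eq_bigr do rewrite -mulrA.
    rewrite -mulr_sumr -(@pairingE phi (fmono R (b i)))// pairing_fmono.
    have /mem_std_box[? ?] := bS i; rewrite phis// /b nth_uniq ?std_box_uniq//.
  rewrite (eq_bigr _ (fun t _ => val t)) (bigD1 j)//= big1 => [|i /negPf ->].
    by rewrite eqxx mulr1 addr0.
  by rewrite mulr0.
have [c Wc] := std_span q N df.
have {}Wc : rel_ideal q N
    (fun m => f m - \sum_(i < size S) (\row_i c (b i)) 0 i * fmono R (b i) m).
  move: Wc; congr rel_ideal; apply/funext => m; congr (_ - _).
  rewrite -/S (big_nth 1%M) big_mkord; apply: eq_bigr => i _.
  by rewrite mxE.
exists (\row_i c (b i)); split=> // c' Wc'.
by apply/rowP => j; rewrite (cE _ j Wc) (cE _ j Wc').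
Qed.

End Ideals.

Theorem theorem5p1 (R : realType) :
  (forall i : int, brel (0 : R[i]) i = fmul (fvar R i) (fvar R (i + 1))) /\
  (forall q : R[i], flat_deformation (@brel R) q).
Proof.
split=> [i|q]; first by rewrite brel0 /fvar fmul_fmonoM.
split=> [q' k|k|d].
- exact: brel_homogeneous.
- by exists (lead k); exact: brel0.
(* The number of standard monomials in the box does not involve [q], so [dimN_brel] gives the same
   dimension at [q] and at 0. *)
- by exists 0 => N _; exists (size (std_box N d)); exact: dimN_brel.
Qed.
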